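(* Each of the following holds. (i) For any positive integer $b\neq 2$, there exists a gcd-closed set $S_1$ with $|S_1|=4$ and $\max_{x\in S_1}|G_{S_1}(x)|=2$ which does not satisfy the condition $\mathcal{G}$, such that $(S_1)\mid(S_1^b)$ holds in $M_4(\mathbb{Z})$. (ii) For $b=3$, or for any integer $b\ge 4$ with $b\not\equiv 1,5\pmod 6$, there exists a gcd-closed set $S_2$ with $|S_2|=4$ and $\max_{x\in S_2}|G_{S_2}(x)|=2$ which does not satisfy the condition $\mathcal{G}$, such that $(S_2)\mid[S_2^b]$ holds in $M_4(\mathbb{Z})$. (iii) There exist an integer $b>1$ and a gcd-closed set $S_3$ with $\max_{x\in S_3}|G_{S_3}(x)|=2$, $|S_3|\in\{4,5\}$, which does not satisfy the condition $\mathcal{G}$, such that $[S_3]\mid[S_3^b]$ holds in $M_{|S_3|}(\mathbb{Z})$.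
   Context: For positive integers $x,y$, $(x,y)$ and $[x,y]$ denote their gcd and lcm. A finite set $S=\{x_1,\dots,x_n\}$ of distinct positive integers is gcd closed if $(x_i,x_j)\in S$ for all $i,j$. For a positive integer $a$, $(S^a)$ denotes the $n\times n$ matrix with $(i,j)$-entry $(x_i,x_j)^a$ and $[S^a]$ the $n\times n$ matrix with $(i,j)$-entry $[x_i,x_j]^a$; $(S)=(S^1)$ and $[S]=[S^1]$. For $x,y\in S$ with $x<y$, $x$ is a greatest-type divisor of $y$ in $S$ if $x\mid y$ and whenever $d\in S$ with $x\mid d\mid y$ then $d\in\{x,y\}$; $G_S(y)$ is the set of greatest-type divisors of $y$ in $S$. Two distinct elements $y_1,y_2\in G_S(x)$ satisfy condition $\mathcal{G}$ if $[y_1,y_2]=x$ and $(y_1,y_2)\in G_S(y_1)\cap G_S(y_2)$; $x$ satisfies condition $\mathcal{G}$ if any two distinct elements of $G_S(x)$ satisfy it; a set $S$ satisfies condition $\mathcal{G}$ if every $x\in S$ has either $|G_S(x)|\le1$, or $|G_S(x)|\ge2$ and $x$ satisfies condition $\mathcal{G}$. For $A,B\in M_n(\mathbb{Z})$, $A\mid B$ in $M_n(\mathbb{Z})$ means there exists $C\in M_n(\mathbb{Z})$ with $B=AC$ or $B=CA$. *)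

(* Defs.v *)
From mathcomp Require Export all_boot all_order all_algebra.

Set Implicit Arguments.
Unset Strict Implicit.
Unset Printing Implicit Defensive.

(* A finite set {x_1, ..., x_n} of positive integers is given by a
   duplicate-free enumeration, as the matrices below depend on the order of
   the elements. *)
Definition posint_set (S : seq nat) : Prop :=
  uniq S /\ (forall x, x \in S -> 0 < x).

Definition gcd_closed (S : seq nat) : Prop :=
  forall x y, x \in S -> y \in S -> gcdn x y \in S.

Definition is_greatest_type_divisor (S : seq nat) (x y : nat) : bool :=
  [&& x < y, x %| y
    & all (fun d => (x %| d) && (d %| y) ==> (d \in [:: x; y])) S].

(* G_S(y); without repetition when S is, so that its size is |G_S(y)|. *)
Definition greatest_type_divisors (S : seq nat) (y : nat) : seq nat :=
  [seq x <- S | is_greatest_type_divisor S x y].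

Definition max_card_gtd (S : seq nat) : nat :=
  \max_(x <- S) size (greatest_type_divisors S x).

Definition pair_condG (S : seq nat) (x y1 y2 : nat) : Prop :=
  lcmn y1 y2 = x /\
  gcdn y1 y2 \in greatest_type_divisors S y1 /\
  gcdn y1 y2 \in greatest_type_divisors S y2.

Definition elt_condG (S : seq nat) (x : nat) : Prop :=
  forall y1 y2, y1 \in greatest_type_divisors S x ->
    y2 \in greatest_type_divisors S x -> y1 <> y2 -> pair_condG S x y1 y2.

Definition condG (S : seq nat) : Prop :=
  forall x, x \in S ->
    size (greatest_type_divisors S x) <= 1 \/
    (2 <= size (greatest_type_divisors S x) /\ elt_condG S x).

Definition gcd_mx (n : nat) (S : n.-tuple nat) (a : nat) : 'M[int]_n :=
  (\matrix_(i, j) Posz (gcdn (tnth S i) (tnth S j) ^ a)%N)%R.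

Definition lcm_mx (n : nat) (S : n.-tuple nat) (a : nat) : 'M[int]_n :=
  (\matrix_(i, j) Posz (lcmn (tnth S i) (tnth S j) ^ a)%N)%R.

Definition mx_divides (n : nat) (A B : 'M[int]_n) : Prop :=
  exists C : 'M[int]_n, B = (A *m C)%R \/ B = (C *m A)%R.

(* Main.v *)
(* Scaling a set S by m multiplies (S) and [S] by m, but (S^b) and [S^b] by m^b.
   Hence, once m (S)^-1 and m [S]^-1 are integral, (mS) and [mS] divide
   every integral multiple of m^2, in particular (mS^b) and [mS^b] for all
   b >= 2. The set {1, 2, 3, 12} is gcd closed and violates condition G at 12,
   since [2, 3] = 6, and m = 72 clears the denominators of both inverses; the
   single set 72 {1, 2, 3, 12} = {72, 144, 216, 864} serves for all three
   parts. *)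
Require Import Defs.

Set Implicit Arguments.
Unset Strict Implicit.
Unset Printing Implicit Defensive.

Import GRing.Theory.

(** If [B = d B'] with [B'] integral, then [A (E B') = d B' = B]. *)
Lemma mx_divides_scalar (n : nat) (A E B : 'M[int]_n) (d : int) :
  (A *m E)%R = (d%:M)%R -> (forall i j, (d %| B i j)%Z) -> mx_divides A B.
Proof.
move=> AE dB; exists (E *m (\matrix_(i, j) (B i j %/ d)%Z))%R; left.
rewrite mulmxA AE mul_scalar_mx; apply/matrixP => i j.
by rewrite !mxE mulrC divzK.
Qed.

Definition scaled_set : 4.-tuple nat := [tuple 72; 144; 216; 864].

Definition mx_of_rows (n : nat) (r : seq (seq int)) : 'M[int]_n :=
  (\matrix_(i, j) nth 0 (nth [::] r i) j)%R.

Lemma mem_scaled_setP (P : nat -> Prop) :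
  P 72 -> P 144 -> P 216 -> P 864 -> forall x, x \in scaled_set -> P x.
Proof.
by move=> P1 P2 P3 P4 x; rewrite !inE => /or4P[] /eqP ->.
Qed.

Lemma scaled_set_posint : posint_set scaled_set.
Proof. by split=> //; apply: mem_scaled_setP. Qed.

Lemma scaled_set_gcd_closed : gcd_closed scaled_set.
Proof.
(* With [y] moved behind [xS], the goal fits [mem_scaled_setP] twice, leaving 16 gcds to compute. *)
move=> x y xS; move: x xS y.
by apply: mem_scaled_setP; apply: mem_scaled_setP; vm_compute.
Qed.

Lemma scaled_set_max_card_gtd : max_card_gtd scaled_set = 2.
Proof. by rewrite /max_card_gtd !big_cons big_nil; vm_compute. Qed.

Lemma scaled_set_not_condG : ~ condG scaled_set.
Proof.
have gtd864 : greatest_type_divisors scaled_set 864 = [:: 144; 216].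
  by vm_compute.
move=> /(_ 864 isT); rewrite gtd864 => -[//|[_]].
(* The pair fails the lcm clause: [144, 216] = 432, not 864. *)
move=> /(_ 144 216); rewrite gtd864 => /(_ isT isT) [//|/eqP + _].
by vm_compute.
Qed.

(* 72 times the inverse of the gcd matrix of {1, 2, 3, 12}. *)
Definition gcd_mx_quasi_inverse : 'M[int]_4 := mx_of_rows 4
  [:: [:: 189; -81; -45; 9]; [:: -81; 81; 9; -9];
      [:: -45; 9; 45; -9]; [:: 9; -9; -9; 9]]%Z.

(* 72 times the inverse of the lcm matrix of {1, 2, 3, 12}. *)
Definition lcm_mx_quasi_inverse : 'M[int]_4 := mx_of_rows 4
  [:: [:: 108; -72; -60; 24]; [:: -72; 36; 48; -12];
      [:: -60; 48; 20; -8]; [:: 24; -12; -8; 2]]%Z.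

(** One factor 72 comes from scaling the set, the other from clearing the denominators of the
    inverse. *)
Lemma gcd_mx_mul_quasi_inverse :
  (gcd_mx scaled_set 1 *m gcd_mx_quasi_inverse)%R = ((Posz (72 ^ 2))%:M)%R.
Proof.
apply/matrixP => i j; rewrite mxE !big_ord_recl big_ord0 !mxE; apply/eqP.
by case: i => -[|[|[|[|//]]]] ?; case: j => -[|[|[|[|//]]]] ?; vm_compute.
Qed.

Lemma lcm_mx_mul_quasi_inverse :
  (lcm_mx scaled_set 1 *m lcm_mx_quasi_inverse)%R = ((Posz (72 ^ 2))%:M)%R.
Proof.
apply/matrixP => i j; rewrite mxE !big_ord_recl big_ord0 !mxE; apply/eqP.
by case: i => -[|[|[|[|//]]]] ?; case: j => -[|[|[|[|//]]]] ?; vm_compute.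
Qed.

Lemma dvdn_scaled_set (i : 'I_4) : 72 %| tnth scaled_set i.
Proof. by apply: (@mem_scaled_setP (fun x => 72 %| x)) (mem_tnth i _). Qed.

Lemma dvdz_exp_ge2 (m x b : nat) :
  1 < b -> m %| x -> (Posz (m ^ 2) %| Posz (x ^ b))%Z.
Proof.
move=> b2 mx; rewrite dvdzE /=.
exact: dvdn_trans (dvdn_exp2l m b2) (dvdn_exp2r b mx).
Qed.

Lemma dvdz_gcd_mx (b : nat) (i j : 'I_4) :
  1 < b -> (Posz (72 ^ 2) %| gcd_mx scaled_set b i j)%Z.
Proof.
move=> b2; rewrite mxE; apply: dvdz_exp_ge2 => //.
by rewrite dvdn_gcd !dvdn_scaled_set.
Qed.

Lemma dvdz_lcm_mx (b : nat) (i j : 'I_4) :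
  1 < b -> (Posz (72 ^ 2) %| lcm_mx scaled_set b i j)%Z.
Proof.
move=> b2; rewrite mxE; apply: dvdz_exp_ge2 => //.
exact: dvdn_trans (dvdn_scaled_set i) (dvdn_lcml _ _).
Qed.

Theorem theorem1p3 :
  (forall b : nat, 0 < b -> b <> 2 ->
     exists S1 : 4.-tuple nat,
       posint_set S1 /\ gcd_closed S1 /\ max_card_gtd S1 = 2 /\ ~ condG S1 /\
       mx_divides (gcd_mx S1 1) (gcd_mx S1 b)) /\
  (forall b : nat,
     b = 3 \/ (4 <= b /\ b <> 1 %[mod 6] /\ b <> 5 %[mod 6]) ->
     exists S2 : 4.-tuple nat,
       posint_set S2 /\ gcd_closed S2 /\ max_card_gtd S2 = 2 /\ ~ condG S2 /\
       mx_divides (gcd_mx S2 1) (lcm_mx S2 b)) /\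
  (exists (b n : nat) (S3 : n.-tuple nat),
     1 < b /\ (n = 4 \/ n = 5) /\
     posint_set S3 /\ gcd_closed S3 /\ max_card_gtd S3 = 2 /\ ~ condG S3 /\
     mx_divides (lcm_mx S3 1) (lcm_mx S3 b)).
Proof.
have [S_pos S_gcd] := (scaled_set_posint, scaled_set_gcd_closed).
have [S_max S_nG] := (scaled_set_max_card_gtd, scaled_set_not_condG).
split; [|split].
- move=> b b_gt0 _; exists scaled_set; do 4!(split=> //).
  (* For [b = 1] the entry 72 is not a multiple of [72 ^ 2], but both matrices coincide. *)
  have [->|b_neq1] := eqVneq b 1.
    by exists 1%:M%R; left; rewrite mulmx1.
  have b_gt1 : 1 < b by rewrite ltn_neqAle eq_sym b_neq1.
  apply: (mx_divides_scalar gcd_mx_mul_quasi_inverse) => i j.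
  exact: dvdz_gcd_mx.
- move=> b b_val; exists scaled_set; do 4!(split=> //).
  have b_gt1 : 1 < b by case: b_val => [->|[/ltnW/ltnW]].
  apply: (mx_divides_scalar gcd_mx_mul_quasi_inverse) => i j.
  exact: dvdz_lcm_mx.
(* The exponent 2 is the least one that [dvdz_lcm_mx] admits. *)
- exists 2, 4, scaled_set; split=> //; split; first by left.
  do 4!(split=> //).
  apply: (mx_divides_scalar lcm_mx_mul_quasi_inverse) => i j.
  exact: dvdz_lcm_mx.
Qed.
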